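(* There is an absolute constant $c>0$ such that for every text $T$ of length $n\ge 2$ whose last character is a sentinel that occurs nowhere else in $T$, \[ L(T)=\sum_{S\in\mathcal{S}(T)}\phi(S)\cdot|S|\ \le\ c\,n\log\delta . \]
   Context: With $f(W)$ the number of occurrences of $W$ in $T$, an occurrence $(s,e)$, $1\le s\le e\le n$, is a net occurrence if $f(T[s\ldots e])\ge 2$, $f(T[s-1\ldots e])=1$ and $f(T[s\ldots e+1])=1$, where the second condition is considered true when $s=1$ and the third when $e=n$. $\phi(S)$ is the number of net occurrences $(s,e)$ with $T[s\ldots e]=S$; $\mathcal{S}(T)$ is the set of substrings $S$ of $T$ with $\phi(S)>0$. For $k\in[n]$, $S(k)$ denotes the number of distinct substrings of length $k$ of $T$, and $\delta=\max\{S(k)/k: k\in[n]\}$. *)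

(* Defs.v *)
From mathcomp Require Import all_boot all_order all_algebra.
From mathcomp Require Import all_classical all_reals all_analysis.

Set Implicit Arguments.
Unset Strict Implicit.
Unset Printing Implicit Defensive.

Import Order.TTheory GRing.Theory Num.Theory.

Section Texts.
Variable A : eqType.
Implicit Types (T W : seq A) (s e k : nat).

(* T[s..e], with positions of T numbered from 1; meant for
   1 <= s <= e <= size T. *)
Definition substring T s e : seq A := drop s.-1 (take e T).

Definition intervals T : seq (nat * nat) :=
  [seq (s, e) | s <- iota 1 (size T), e <- iota s ((size T).+1 - s)].

Definition freq T W : nat :=
  count (fun p => substring T p.1 p.2 == W) (intervals T).

Definition net_occurrence T (p : nat * nat) : bool :=
  let: (s, e) := p in
  [&& (1 <= s <= e) && (e <= size T),
      2 <= freq T (substring T s e),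
      (s == 1) || (freq T (substring T s.-1 e) == 1)
    & (e == size T) || (freq T (substring T s e.+1) == 1)].

Definition net_freq T W : nat :=
  count (fun p => net_occurrence T p && (substring T p.1 p.2 == W))
        (intervals T).

Definition substrings T : seq (seq A) :=
  undup [seq substring T p.1 p.2 | p <- intervals T].

Definition net_strings T : seq (seq A) :=
  [seq W <- substrings T | 0 < net_freq T W].

Definition net_length T : nat :=
  \sum_(W <- net_strings T) net_freq T W * size W.

Definition substring_complexity T k : nat :=
  count (fun W => size W == k) (substrings T).

(* The default value 0 is harmless: all the ratios are nonnegative. *)
Definition delta (R : realType) T : R :=
  \big[Num.max/0%R]_(1 <= k < (size T).+1)
    ((substring_complexity T k)%:R / k%:R)%R.

Definition ends_with_sentinel T : Prop :=
  exists (U : seq A) (d : A), T = rcons U d /\ d \notin U.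

End Texts.

Arguments delta {A} R T.

(* Main.v *)
Require Import Defs.
From mathcomp Require Import all_boot all_order all_algebra.
From mathcomp Require Import all_classical all_reals all_analysis.
From mathcomp Require Import zify ring lra.

(** Write a net occurrence as a half-open interval [[e - l, e)].  Each end [e]
    carries at most one, and at any partner end [f] where the same [l] letters
    precede, the next letter differs.  Hence for every depth [d] with
    [l/2 < d <= l] the windows starting at [e - d] and [f - d] agree on [d]
    letters and then branch, and one of the two branches contains at most half
    of the occurrences of the window; charge its starting position.  If [N]
    positions are considered and all [l >= 4h], then a branch with more than
    [N/h] occurrences has two that overlap, hence a period below [h]; both
    branches cannot have that, as periodicity would determine the next letter.
    So every charged branch has at most [N/h] occurrences, a position is charged
    O(log(N/h)) times, and the total length is O(N log(N/h)).

    For lengths at least about [n/delta] take all [N = n] positions.  For lengths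
    in [[2^i, 2^(i+1))] below that, it suffices to consider the positions close
    to the leftmost occurrences of windows of length O(2^i): there are only
    O(delta 2^i) of them, and summing the geometric series gives
    O(n log delta) again. *)

Set Implicit Arguments.
Unset Strict Implicit.
Unset Printing Implicit Defensive.

Import Order.TTheory GRing.Theory Num.Theory.

(** * Windows of an infinite word: agreement, colexicographic order, periods *)

Section Windows.
Variable t : nat -> nat.

Definition weq d p q := all (fun j => t (p + j) == t (q + j)) (iota 0 d).

Lemma weqP d p q :
  reflect (forall j, j < d -> t (p + j) = t (q + j)) (weq d p q).
Proof.
apply: (iffP allP) => [h j ltjd|h j]; first by apply/eqP/h; rewrite mem_iota.
by rewrite mem_iota /= => ltjd; apply/eqP/h.
Qed.

Lemma weq_refl d p : weq d p p.
Proof. exact/weqP. Qed.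

Lemma weq_sym d p q : weq d p q = weq d q p.
Proof. by apply/weqP/weqP => h j /h. Qed.

Lemma weq_trans d : transitive (weq d).
Proof. by move=> q p r /weqP h1 /weqP h2; apply/weqP => j lt; rewrite h1 ?h2. Qed.

Lemma weq_shift i d p q : weq (i + d) p q -> weq d (p + i) (q + i).
Proof. by move=> /weqP h; apply/weqP => j lt; rewrite -!addnA h // ltn_add2l. Qed.

Lemma weq_le d d' p q : d <= d' -> weq d' p q -> weq d p q.
Proof. by move=> le /weqP h; apply/weqP => j /leq_trans/(_ le)/h. Qed.

Lemma weqS d p q : weq d.+1 p q = weq d p q && (t (p + d) == t (q + d)).
Proof. by rewrite /weq -addn1 iotaD all_cat /= andbT. Qed.

(** The first [e] letters read backwards: common suffixes become common prefixes for the
    lexicographic order. *)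
Definition left_context e : seqlexi nat := mkseq (fun i => t (e - i.+1)) e.

Lemma take_left_context l e :
  l <= e -> take l (left_context e) = mkseq (fun i => t (e - i.+1)) l.
Proof. by move=> le; rewrite /left_context /mkseq -map_take take_iota (minn_idPl le). Qed.

Lemma take_left_contextP l e f : l <= e -> l <= f ->
  reflect (take l (left_context e) = take l (left_context f))
          (weq l (e - l) (f - l)).
Proof.
move=> le lf; rewrite !take_left_context //.
apply: (iffP (weqP _ _ _)) => [h|h j lt].
  apply/eq_in_map => i; rewrite mem_iota /= => lt.
  have -> : e - i.+1 = e - l + (l - i.+1) by lia.
  have -> : f - i.+1 = f - l + (l - i.+1) by lia.
  by apply: h; lia.
move: h => /eq_in_map/(_ (l - j.+1)); rewrite mem_iota /= => h.
have -> : e - l + j = e - (l - j.+1).+1 by lia.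
have -> : f - l + j = f - (l - j.+1).+1 by lia.
by apply: h; lia.
Qed.

Lemma lexi_take_convex l (a b c : seqlexi nat) :
  (a <= c)%O -> (c <= b)%O -> l <= size a -> take l a = take l b ->
  take l c = take l a.
Proof.
elim: l a b c => [|l IH] [|x a] [|y b] [|z c] //= ac cb la [exy eab].
move: ac cb; rewrite !lexi_cons -exy !leEnat => /andP[xz /implyP ac] /andP[zx /implyP cb].
have exz : x = z by apply/eqP; rewrite eqn_leq xz zx.
by subst z; rewrite (IH a b c) //; [apply: ac|apply: cb].
Qed.

Definition colex : rel nat := fun e f => (left_context e <= left_context f)%O.

(** Reversed contexts sharing a prefix form an interval of the lexicographic order. This lets an
    adjacent end replace an arbitrary partner. *)
Lemma colex_convex l e f g : colex e g -> colex g f -> l <= e -> l <= f ->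
  weq l (e - l) (f - l) -> l <= g /\ weq l (e - l) (g - l).
Proof.
move=> eg gf le lf /(take_left_contextP le lf) eq_ef.
have h : take l (left_context g) = take l (left_context e).
  by apply: lexi_take_convex eg gf _ eq_ef; rewrite size_mkseq.
have lg : l <= g.
  have := congr1 size h; rewrite !size_take_min !size_mkseq; lia.
by split=> //; apply/(take_left_contextP le lg).
Qed.

(* A window that occurs at both [q] and [q + r] has period [r]. *)
Lemma weq_period_eq d r r' p p' q q' :
  0 < r -> 0 < r' -> r + r' <= d -> weq d p p' ->
  weq d.+1 p q -> weq d.+1 p (q + r) ->
  weq d.+1 p' q' -> weq d.+1 p' (q' + r') -> weq d.+1 p p'.
Proof.
move=> r0 r0' le pp' /weqP pq /weqP pqr /weqP pq' /weqP pqr'.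
rewrite weqS pp' /=; move/weqP: pp' => pp'.
have per j : r <= j <= d -> t (p + j) = t (p + (j - r)).
  move=> /andP[le_rj le_jd]; rewrite pq; last by lia.
  by rewrite pqr; [congr t|]; lia.
have per' j : r' <= j <= d -> t (p' + j) = t (p' + (j - r')).
  move=> /andP[le_rj le_jd]; rewrite pq'; last by lia.
  by rewrite pqr'; [congr t|]; lia.
have -> : t (p + d) = t (p' + (d - r - r')).
  by rewrite (per d) ?(pp' (d - r)) ?(per' (d - r)) //; lia.
rewrite (per' d); last by lia.
rewrite -(pp' (d - r')); last by lia.
rewrite (per (d - r')); last by lia.
by rewrite (pp' (d - r' - r)) 1?subnAC //; lia.
Qed.

End Windows.

(** * Pigeonhole, halving and summation lemmas *)

Lemma close_pair (P Q : pred nat) n h :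
  0 < h -> (forall j, P j -> j < n) -> (forall q i, Q q -> i < h -> P (q + i)) ->
  count P (iota 0 n) %/ h < count Q (iota 0 n) ->
  exists q r, [/\ 0 < r, r < h, Q q & Q (q + r)].
Proof.
move=> h0 Pn QP many.
(* Without a close pair the blocks [[q, q + h)] would be disjoint parts of [P], too many to fit. *)
pose s := [seq q + i | q <- seq.filter Q (iota 0 n), i <- iota 0 h].
have size_s : size s = count Q (iota 0 n) * h.
  by rewrite size_allpairs size_filter size_iota.
have sP : {subset s <= seq.filter P (iota 0 n)}.
  move=> x /allpairsP[[q i] /= []]; rewrite mem_filter !mem_iota /= => /andP[Qq _] lt ->.
  by rewrite mem_filter mem_iota /= QP //= Pn // QP.
have : ~~ uniq s.
  apply: contraL many => us; rewrite -leqNgt leq_divRL // -size_s -size_filter.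
  exact: uniq_leq_size.
move=> /negP nu; apply: contrapT => nex; apply: nu; apply: allpairs_uniq; rewrite ?filter_uniq ?iota_uniq //.
have gap q q' i i' : Q q -> Q q' -> i < h -> q + i = q' + i' -> q' <= q.
  move=> Qq Qq' ih e; rewrite leqNgt; apply/negP => lt; apply: nex.
  by exists q, (q' - q); rewrite subnKC; [split=> //; lia|lia].
move=> [q i] [q' i'] /allpairsP[[q1 i1] /= []] + + [-> ->].
rewrite mem_filter !mem_iota /= => /andP[Qq _] ih.
move=> /allpairsP[[q2 i2] /= []] + + [-> ->].
rewrite mem_filter !mem_iota /= => /andP[Qq' _] ih' e.
have := gap _ _ _ _ Qq Qq' ih e.
have := gap _ _ _ _ Qq' Qq ih' (esym e).
move=> l1 l2; have eq1 : q1 = q2 by lia.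
by rewrite eq1; congr pair; lia.
Qed.

(** After the lowest counted depth [c] is at most [K]; each further one halves it, and it is still
    positive at [b]. *)
Lemma count_halvings (c : nat -> nat) K a b :
  (forall d, c d.+1 <= c d) -> 0 < c b -> 
  count (fun d => (a <= d) && (2 * c d.+1 <= c d) && (c d.+1 <= K)) (iota 0 b)
    <= (trunc_log 2 K).+1.
Proof.
move=> cS cb0; set l := fun d => _.
suff : count l (iota 0 b) = 0 \/ 2 ^ (count l (iota 0 b)).-1 * c b <= K.
  case: (count l _) => [|m] [] //= h.
  rewrite ltnS; apply: trunc_log_max => //; apply: leq_trans h.
  by rewrite leq_pmulr.
elim: b {cb0} => [|b IH]; first by left.
rewrite -addn1 iotaD count_cat add0n /= addn0 addn1.
case lb : (l b); last first.
  rewrite addn0; case: IH => [->|IH]; [by left|right].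
  by apply: leq_trans IH; rewrite leq_mul2l cS orbT.
right; move: lb; rewrite /l => /andP[/andP[_ half] leK].
rewrite addn1 /=; case: IH => [->|]; first by rewrite expn0 mul1n.
case: (count _ _) => [|m] /= IH; first by rewrite expn0 mul1n.
by apply: leq_trans IH; rewrite expnSr -mulnA leq_mul2l half orbT.
Qed.

Lemma leq_sum_nat (F G : nat -> nat) a b :
  (forall i, a <= i < b -> F i <= G i) ->
  \sum_(a <= i < b) F i <= \sum_(a <= i < b) G i.
Proof.
move=> FG; rewrite big_seq [leqRHS]big_seq; apply: leq_sum => i.
by rewrite mem_index_iota; apply: FG.
Qed.

Lemma leq_sum_nat_sub (F : nat -> nat) a b c : b <= c ->
  \sum_(a <= i < b) F i <= \sum_(0 <= i < c) F i.
Proof.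
move=> bc; case: (leqP a b) => [ab|/ltnW ba]; last by rewrite big_geq.
have ac := leq_trans ab bc; rewrite (big_cat_nat (n := a) (p := c)) //=.
by rewrite (big_cat_nat (m := a) (n := b) (p := c)) //= addnCA leq_addr.
Qed.

Lemma sum_shift_neighbours (f : nat -> nat) k : f k = 0 ->
  \sum_(0 <= i < k) (f i + f i.+1 + (if i is j.+1 then f j else 0))
    <= 3 * \sum_(0 <= i < k) f i.
Proof.
move=> fk; rewrite !big_split /= mulSn mulSn mul1n addnA.
apply: leq_add; first apply: leq_add => //.
  have := leqnn (\sum_(0 <= i < k.+1) f i).
  by rewrite {1}big_nat_recl // big_nat_recr //= fk addn0; apply: leq_trans; rewrite leq_addl.
case: k {fk} => [|k]; first by rewrite !big_nil.
by rewrite big_nat_recl // big_nat_recr //= leq_addr.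
Qed.

(** * The charging argument *)

Section Charging.
Variables (t : nat -> nat) (n h m : nat) (P : pred nat).
Hypothesis h_gt0 : 0 < h.
Hypothesis P_lt : forall j, P j -> j < n.

(* The charge argument counts only occurrences whose first [h] positions lie in
   [P], so that many of them must overlap. *)
Definition inner q := all (fun i => P (q + i)) (iota 0 h).

Lemma innerP q i : inner q -> i < h -> P (q + i).
Proof. by move=> /allP ing ltih; apply: ing; rewrite mem_iota. Qed.

Lemma inner_sub q : inner q -> P q.
Proof. by move=> /innerP/(_ h_gt0); rewrite addn0. Qed.

Definition occ x d := count (fun q => inner q && weq t d x q) (iota 0 n).

Definition max_occ := count P (iota 0 n) %/ h.

(** The halving condition limits how often a position is charged; [2 * h <= d] leaves room for two
    periods below [h]. *)
Definition light x d :=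
  (2 * h <= d) && (2 * occ x d.+1 <= occ x d) && (occ x d.+1 <= max_occ).

Definition charge e := \sum_(0 <= d < e.+1) (inner (e - d) && light (e - d) d).

Lemma occ_gt0 x d : inner x -> 0 < occ x d.
Proof.
move=> ix; rewrite -has_count; apply/hasP; exists x.
  by rewrite mem_iota /=; apply/P_lt/inner_sub.
by rewrite ix weq_refl.
Qed.

Lemma occS x d : occ x d.+1 <= occ x d.
Proof. by apply: sub_count => q /= /andP[-> /weq_le]; apply. Qed.

Lemma occ_eq x y d : weq t d x y -> occ x d = occ y d.
Proof.
move=> xy; apply: eq_count => q /=; congr (_ && _).
apply/idP/idP => [xq|]; last exact: weq_trans xy.
by apply: weq_trans xq; rewrite weq_sym.
Qed.

(* If both extensions had more than [max_occ] inner occurrences, each would have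
   a period below [h], and then the two next letters would agree. *)
Lemma light_branch p q d : inner p -> inner q -> 2 * h <= d ->
  weq t d p q -> ~~ weq t d.+1 p q -> light p d || light q d.
Proof.
move=> ip iq hd pq npq; rewrite /light hd /= -(occ_eq pq).
have le_sum : occ p d.+1 + occ q d.+1 <= occ p d.
  rewrite /occ -count_predUI addnC.
  rewrite (eq_count (a2 := pred0)) ?count_pred0 => [|y /=]; last first.
    apply/negP => /andP[/andP[_ py] /andP[_ qy]]; case/negP: npq.
    by apply: weq_trans py _; rewrite weq_sym.
  apply: sub_count => y /= /orP[] /andP[-> w] /=; first exact: weq_le w.
  by apply: weq_trans pq _; apply: weq_le w.
have minK : (occ p d.+1 <= max_occ) || (occ q d.+1 <= max_occ).
  apply: contraNT npq; rewrite negb_or -!ltnNge => /andP[].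
  have innP x y i : inner y && weq t d.+1 x y -> i < h -> P (y + i).
    by move=> /andP[iy _]; apply: innerP.
  move=> /(close_pair h_gt0 P_lt (innP p))[y [r [r0 rh /andP[_ w1] /andP[_ w2]]]].
  move=> /(close_pair h_gt0 P_lt (innP q))[z [r' [r0' rh' /andP[_ w3] /andP[_ w4]]]].
  by apply: (weq_period_eq r0 r0' _ pq w1 w2 w3 w4); lia.
move: le_sum minK; clear; lia.
Qed.

(** Regroup the charges by starting position [x = e - d]: only inner [x] contribute, and
    [count_halvings] bounds the light depths of each. *)
Lemma sum_charge :
  \sum_(0 <= e < n.+1) charge e <= count P (iota 0 n) * (trunc_log 2 max_occ).+1.
Proof.
pose G x d : nat := inner x && light x d.
have -> : \sum_(0 <= e < n.+1) charge e =
    \sum_(0 <= e < n.+1) \sum_(0 <= x < n.+1 | x <= e) G x (e - x).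
  apply: eq_big_nat => e /andP[_ le]; rewrite /charge big_nat_rev /= (big_nat_widen _ _ n.+1) //.
  apply: eq_big => [x|x]; rewrite ?ltnS //= => lx.
  by rewrite add0n subSS subKn.
rewrite (exchange_big_dep_nat xpredT) //=.
set M := (trunc_log 2 max_occ).+1.
have -> : count P (iota 0 n) = \sum_(0 <= x < n.+1) P x.
  rewrite big_nat_recr //= -sum1_count big_mkcond /index_iota subn0.
  have /negbTE-> : ~~ P n by apply/negP => /P_lt; rewrite ltnn.
  by rewrite addn0; apply: eq_bigr => i _; case: (P i).
rewrite big_distrl; apply: leq_sum => x _.
case ix : (inner x); last by rewrite big1 // => e _; rewrite /G ix.
rewrite (inner_sub ix) /= mul1n.
apply: leq_trans (count_halvings max_occ (2 * h) (occS x) (occ_gt0 n.+1 ix)).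
rewrite -/(light x) -sum1_count [leqRHS]big_mkcond /=.
have -> : \sum_(0 <= e < n.+1 | x <= e) G x (e - x) =
    \sum_(x <= e < n.+1) G x (e - x).
  by rewrite [RHS](big_nat_widenl _ 0).
rewrite -{1}[x]add0n big_addn; apply: (@leq_trans (\sum_(0 <= d < n.+1) G x d)).
  rewrite (eq_bigr (G x)) => [|d _]; last by rewrite addnK.
  by apply: leq_sum_nat_sub; rewrite leq_subr.
rewrite /index_iota subn0; apply: leq_sum => d _.
by rewrite /G ix /light; case: ifP.
Qed.

(** * Total length of the ends in [F], with partners taken from [E] *)

Section Nets.
Variables (E F : pred nat) (len : nat -> nat).
Hypothesis E_P : forall e j, E e -> j < e <= j + m -> P j.
Hypothesis F_E : forall e, F e -> E e.
Hypothesis len_bounds : forall e, F e -> (4 * h <= len e <= m) && (len e <= e).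
Hypothesis right_unique : forall e q, F e ->
  weq t (len e).+1 (e - len e) q -> q = e - len e.
Hypothesis repeated : forall e, F e -> exists f,
  [/\ f <= n, E f, f != e, len e <= f & weq t (len e) (e - len e) (f - len e)].

Lemma len_le_charge e f : F e -> E f -> f != e -> len e <= f ->
  weq t (len e) (e - len e) (f - len e) -> len e <= 2 * (charge e + charge f).
Proof.
move=> Fe Ef fe; have := len_bounds Fe; have uniq_e := right_unique Fe.
set l := len e in uniq_e * => lb lf w.
apply: (@leq_trans (2 * (l - l %/ 2))); first by lia.
rewrite leq_mul2l /=.
pose G x d : nat := inner x && light x d.
have -> : l - l %/ 2 = \sum_((l %/ 2).+1 <= d < l.+1) 1.
  by rewrite sum_nat_const_nat muln1 subSS.
apply: (@leq_trans (\sum_((l %/ 2).+1 <= d < l.+1) (G (e - d) d + G (f - d) d))); last first.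
  by rewrite big_split; apply: leq_add; apply: leq_sum_nat_sub; lia.
apply: leq_sum_nat => d lb_d.
(* The first [h] positions of the window lie before [g] as [h <= d], and within [m] of it as
   [d <= l <= m]. *)
have inn g : E g -> l <= g -> inner (g - d).
  move=> Eg lg; apply/allP => i; rewrite mem_iota /= => ih.
  by apply: (E_P Eg); lia.
have Ee := F_E Fe.
have lel : l <= e by lia.
rewrite /G !inn //=.
have : light (e - d) d || light (f - d) d; last by case: (light _ _); case: (light _ _).
apply: light_branch; rewrite ?inn //; first by lia.
  have -> : e - d = e - l + (l - d) by lia.
  have -> : f - d = f - l + (l - d) by lia.
  by apply: weq_shift; rewrite subnK //; lia.
(* One more common letter would give a second occurrence of the right-unique window of length
   [l + 1]. *)
apply/negP => w'.
have : f - l = e - l.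
  apply: uniq_e; rewrite weqS w /=; move: w'.
  rewrite weqS => /andP[_]; rewrite !subnK ?subnKC //; lia.
by move/eqP: fe; lia.
Qed.

(* The partner of an end [e] is a neighbour of [e] in the colexicographic order
   of [E]: it shares the longest left context, and is the partner of at most
   two ends. *)
Lemma sum_len_le :
  \sum_(0 <= e < n.+1 | F e) len e <=
  6 * (count P (iota 0 n) * (trunc_log 2 max_occ).+1).
Proof.
pose z := sort (colex t) (seq.filter E (iota 0 n.+1)).
(* The default 0 past the end of [z] is the boundary condition of [sum_shift_neighbours]. *)
pose c i := if i < size z then charge (nth 0 z i) else 0.
have sum_z (a : nat -> nat) :
    \sum_(0 <= e < n.+1 | E e) a e = \sum_(0 <= i < size z) a (nth 0 z i).
  rewrite -(big_nth 0 xpredT a) [RHS](perm_big (seq.filter E (iota 0 n.+1))).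
    by rewrite big_filter /index_iota subn0.
  by rewrite perm_sort.
have colex_tr : transitive (colex t) by move=> ? ? ?; apply: le_trans.
have colex_refl : reflexive (colex t) by move=> ?; apply: lexx.
have colex_total : total (colex t) by move=> ? ?; apply: le_total.
have srt : sorted (colex t) z by apply: sort_sorted.
have uz : uniq z by rewrite sort_uniq filter_uniq ?iota_uniq.
have mem_z e : (e \in z) = E e && (e <= n) by rewrite mem_sort mem_filter mem_iota.
have Ez i : i < size z -> E (nth 0 z i).
  by move=> /(mem_nth 0); rewrite mem_z => /andP[].
(* The 6 is 2 from [len_le_charge] times 3 for an end and its two neighbours. *)
apply: (@leq_trans (2 * (3 * \sum_(0 <= i < size z) c i))); last first.
  rewrite mulnA leq_mul2l /=; apply: leq_trans sum_charge.
  rewrite [leqRHS](bigID E) /= sum_z; apply: leq_trans (leq_addr _ _).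
  by apply: leq_sum_nat => i /andP[_ lt]; rewrite /c lt.
apply: leq_trans (_ : _ <= 2 * _) _; last first.
  by rewrite leq_mul2l; apply/orP; right; apply: sum_shift_neighbours; rewrite /c ltnn.
rewrite big_distrr /= (eq_bigl (fun e => E e && F e)) => [|e]; last first.
  by case Fe : (F e); rewrite ?andbF ?(F_E Fe).
rewrite big_mkcondr sum_z; apply: leq_sum_nat => i /andP[_ lti].
case: ifP => // Fe; set e := nth 0 z i in Fe *.
have [f [fn Ef fe lf w]] := repeated Fe.
have lee : len e <= e by case/andP: (len_bounds Fe).
have fz : f \in z by rewrite mem_z Ef fn.
pose j := index f z; have ltj : j < size z by rewrite index_mem.
have ej : nth 0 z j = f by rewrite nth_index.
have ij : j != i by apply: contra fe => /eqP eji; rewrite -ej eji.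
have ci : c i = charge e by rewrite /c lti.
have nz k : k < size z -> k != i -> nth 0 z k != e.
  by move=> ltk; rewrite /e nth_uniq.
have ord a b : a <= b -> b < size z -> colex t (nth 0 z a) (nth 0 z b).
  by move=> ab lb; apply: (sorted_leq_nth colex_tr colex_refl) => //; apply: leq_ltn_trans lb.
case: (ltngtP i j) ij => // ij _.
  have lti1 : i.+1 < size z by apply: leq_ltn_trans ltj.
  have o1 := ord _ _ (leqnSn i) lti1.
  have := ord _ _ ij ltj; rewrite ej => o2.
  have [l1 w1] := colex_convex o1 o2 lee lf w.
  apply: leq_trans (len_le_charge Fe (Ez _ lti1) (nz _ lti1 _) l1 w1) _.
    by rewrite neq_ltn ltnSn orbT.
  have c1 : c i.+1 = charge (nth 0 z i.+1) by rewrite /c lti1.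
  by rewrite leq_mul2l /= ci c1 leq_addr.
case: i ij lti @e Fe lf w lee ci nz fe => // i ij lti e Fe lf w lee ci nz fe.
have lti1 : i < size z by apply: ltnW.
have o1 := ord _ _ (leqnSn i) lti.
have := ord j i ij lti1; rewrite ej => o2.
have w' : weq t (len e) (f - len e) (e - len e) by rewrite weq_sym.
have [l1 w1] := colex_convex o2 o1 lf lee w'.
have w2 := weq_trans w w1.
apply: leq_trans (len_le_charge Fe (Ez _ lti1) (nz _ lti1 _) l1 w2) _.
  by rewrite neq_ltn ltnSn.
have c1 : c i = charge (nth 0 z i) by rewrite /c lti1.
by rewrite leq_mul2l /= ci c1 addnAC leq_addr.
Qed.

End Nets.

End Charging.

(** * Dyadic levels of lengths *)

Lemma trunc_log_le_mul k D N : 0 < D -> N <= 2 ^ k * D ->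
  trunc_log 2 N <= k + trunc_log 2 D.
Proof.
move=> D0 le; apply: leq_trans (leq_trunc_log 2 le) _; elim: k {N le} => [|k IH].
  by rewrite mul1n.
by rewrite expnS -mulnA trunc_logMp ?muln_gt0 ?expn_gt0.
Qed.

Section Levels.
Variables (t : nat -> nat) (n D : nat) (len : nat -> nat).

Definition leftmost m x := ~~ has (weq t m x) (iota 0 x).

Hypothesis D_gt1 : 1 < D.
Hypothesis count_leftmost : forall m, 0 < m ->
  count (leftmost m) (iota 0 n) <= D * m + m.
Hypothesis len_le : forall e, 0 < len e -> len e <= e <= n.
Hypothesis right_unique : forall e q, 0 < len e ->
  weq t (len e).+1 (e - len e) q -> q = e - len e.
Hypothesis repeated : forall e, 0 < len e -> exists f,
  [/\ f <= n, f != e, len e <= f & weq t (len e) (e - len e) (f - len e)].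

Lemma leftmostP m x :
  reflect (forall y, y < x -> ~~ weq t m x y) (leftmost m x).
Proof.
apply: (iffP hasPn) => [h y yx|h y]; first by apply: h; rewrite mem_iota.
by rewrite mem_iota /= => /h.
Qed.

(** An earlier copy of the enclosing window would contain an earlier copy of the inner one. *)
Lemma leftmost_shift a b x y :
  leftmost a x -> y <= x -> a + (x - y) <= b -> leftmost b y.
Proof.
move=> /leftmostP lx yx le; apply/leftmostP => z zy; apply/negP => w.
have zx : z + (x - y) < x by lia.
have /negP := lx _ zx; apply.
have -> : weq t a x (z + (x - y)) = weq t a (y + (x - y)) (z + (x - y)) by rewrite subnKC.
by apply: weq_shift; apply: weq_le w; rewrite addnC.
Qed.

Lemma leftmost_net e : 0 < len e -> leftmost (len e).+1 (e - len e).
Proof.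
move=> l0; apply/leftmostP => y lt; apply/negP => /(right_unique l0); lia.
Qed.

(** Take the smallest other occurrence [y]. An earlier copy of its extension would contradict
    minimality, or start at [e - len e], whose extension is unique. *)
Lemma leftmost_repeat e : 0 < len e -> exists y,
  [/\ y + len e <= n, y != e - len e, weq t (len e) (e - len e) y
    & leftmost (len e).+1 y].
Proof.
move=> l0; set l := len e; set x := e - l.
pose Y y := [&& y + l <= n, y != x & weq t l x y].
have exY : exists y, Y y.
  have [f [fn fe lf w]] := repeated l0; have /andP[le _] := len_le l0.
  exists (f - l); rewrite /Y w subnK // fn /= andbT /x.
  by apply: contra fe => /eqP h; apply/eqP; rewrite -(subnK lf) h subnK.
have [y /and3P[yn yx w] miny] := ex_minnP exY.
exists y; split=> //; apply/leftmostP => z zy; apply/negP => wz.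
have wyz : weq t l y z by apply: weq_le wz.
have : ~~ Y z by apply/negP => /miny; rewrite leqNgt zy.
rewrite /Y (weq_trans w wyz) andbT negb_and negbK.
case/orP => [|/eqP zx]; first by lia.
by move: wz; rewrite zx weq_sym => /(right_unique l0)/eqP; apply/negP.
Qed.

Section Level.
Variables (m : nat).

(* Leftmost windows stay leftmost when extended, so the positions within
   distance [m] of a leftmost window of length [m] are all covered, although
   only O(D m) positions are. *)
Definition covered p := (p < n) && ((p < m) || leftmost (3 * m) (p - m)).

Definition covered_end e :=
  (e <= n) && all (fun j => (e <= j + m) ==> covered j) (iota 0 e).

(** The first [m] positions and at most [3 * D * m + 3 * m] leftmost windows; [1 < D] absorbs
    [4 * m] into [2 * D * m]. *)
Lemma count_covered : 0 < m -> count covered (iota 0 n) <= 5 * D * m.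
Proof.
move=> m0; case: (leqP n m) => [nm|/ltnW mn].
  by apply: leq_trans (count_size _ _) _; rewrite size_iota; nia.
rewrite -{1}(subnKC mn) iotaD count_cat add0n.
have le1 : count covered (iota 0 m) <= m.
  by apply: leq_trans (count_size _ _) _; rewrite size_iota.
have m3 : 0 < 3 * m by lia.
have le2 : count covered (iota m (n - m)) <= count (leftmost (3 * m)) (iota 0 n).
  rewrite -{1}[m]addn0 iotaDl count_map -[in leqRHS](subnK mn) iotaD count_cat.
  apply: leq_trans (leq_addr _ _); rewrite -!sum1_count.
  rewrite big_mkcond [leqRHS]big_mkcond /= [leqRHS]big_seq big_seq.
  apply: leq_sum => p _ /=; rewrite /covered addKn [_ < m]ltnNge leq_addr /=.
  by case: leftmost; rewrite ?andbF //; case: ifP.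
have := count_leftmost m3; move: le1 le2; nia.
Qed.

(** This explains the [3 * m] in [covered]: [m] for the window, [m] for the shift to [j - m], and at
    most [m] for [x - j]. *)
Lemma covered_end_leftmost a x l :
  leftmost a x -> a <= m -> l <= m -> x + l <= n -> covered_end (x + l).
Proof.
move=> lx am lm xn; rewrite /covered_end xn /=; apply/allP => j.
rewrite mem_iota /= => jx; apply/implyP => le; rewrite /covered.
apply/andP; split; first by lia.
case: ltnP => //= mj; apply: (leftmost_shift lx); lia.
Qed.

End Level.

Lemma sum_len_level i : 1 < i ->
  \sum_(0 <= e < n.+1 | 2 ^ i <= len e < 2 ^ i.+1) len e
    <= 60 * D * 2 ^ i * (7 + trunc_log 2 D).
Proof.
(* The largest [h] with [4 * h <= len e] on the whole level; [1 < i] makes it an integer. *)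
move=> i1; pose m := 2 ^ i.+1; pose h := 2 ^ (i - 2).
have eh : 2 ^ i = 4 * h by rewrite /h -{1}(subnKC i1) expnD.
have em : m = 8 * h by rewrite /m expnS eh; lia.
have h0 : 0 < h by rewrite expn_gt0.
rewrite -/m eh.
have := @sum_len_le t n h m (covered m) h0 _ (covered_end m)
  (fun e => 4 * h <= len e < m) len.
have -> : 60 * D * (4 * h) * (7 + trunc_log 2 D) =
  6 * (5 * D * m * (7 + trunc_log 2 D)) by rewrite em; nia.
move=> H; apply: leq_trans (H _ _ _ _ _ _) _ => {H}.
- by move=> j /andP[].
- move=> e j /andP[_ /allP H] /andP[je jm].
  by have := H j; rewrite mem_iota /= jm => /(_ je).
- move=> e F; have l0 : 0 < len e by lia.
  have /andP[le en] := len_le l0; rewrite -(subnK le).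
  by apply: covered_end_leftmost (leftmost_net l0) _ _ _; lia.
- by move=> e F; have l0 : 0 < len e by [lia]; have := len_le l0; lia.
- by move=> e q F; apply: right_unique; lia.
- move=> e F; have l0 : 0 < len e by lia.
  have [y [yn yx w lm]] := leftmost_repeat l0.
  exists (y + len e); rewrite addnK; split=> //; last by rewrite leq_addl.
    by apply: covered_end_leftmost lm _ _ _; lia.
  by apply: contra yx => /eqP h'; apply/eqP; lia.
have m0 : 0 < m by lia.
have cc := count_covered m0.
rewrite leq_mul2l /=; apply: leq_mul => //.
(* With at most [40 * D * h] covered positions, [max_occ] is at most [40 * D <= 2 ^ 6 * D]. *)
rewrite -[7]/(6.+1) addSn ltnS; apply: trunc_log_le_mul; first by lia.
apply: leq_trans (leq_div2r h cc) _.
have -> : 5 * D * m = 40 * D * h by rewrite em; nia.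
by rewrite mulnK // leq_mul2r orbT.
Qed.

(** Here every position below [n] may be used: [n < 8 * D * h] already keeps [max_occ] in O(D). *)
Lemma sum_len_long h : 0 < h -> n < 8 * D * h ->
  \sum_(0 <= e < n.+1 | 4 * h <= len e) len e <= 6 * n * (7 + trunc_log 2 D).
Proof.
move=> h0 nD.
have := @sum_len_le t n h n (fun j => j < n) h0 _ (fun e => e <= n)
  (fun e => 4 * h <= len e) len.
move=> H; apply: leq_trans (H _ _ _ _ _ _) _ => {H} //.
- by move=> e j en /andP[je _]; apply: leq_trans en.
- by move=> e F; have l0 : 0 < len e by [lia]; have /andP[] := len_le l0.
- by move=> e F; have l0 : 0 < len e by [lia]; have := len_le l0; lia.
- by move=> e q F; apply: right_unique; lia.
- move=> e F; have l0 : 0 < len e by lia.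
  by have [f [? ? ? ?]] := repeated l0; exists f.
have cn : count (fun j => j < n) (iota 0 n) <= n.
  by apply: leq_trans (count_size _ _) _; rewrite size_iota.
rewrite -mulnA leq_mul2l /=; apply: leq_mul => //.
rewrite -[7]/(6.+1) addSn ltnS; apply: trunc_log_le_mul; first by lia.
rewrite /max_occ -ltnS ltn_divLR //; apply: leq_ltn_trans cn _; nia.
Qed.

(** Lengths below 4 cost at most 3 per end; the levels from 4 up sum to
    [4 + 8 + ... + 2 ^ k.+1 = 2 ^ k.+2 - 4]. *)
Lemma sum_len_short k :
  \sum_(0 <= e < n.+1 | len e < 2 ^ k.+2) len e
    <= 3 * n.+1 + 60 * D * (2 ^ k.+2 - 4) * (7 + trunc_log 2 D).
Proof.
elim: k => [|k IH].
  rewrite muln0 mul0n addn0 mulnC -[n.+1 in leqRHS]subn0 -sum_nat_const_nat big_mkcond.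
  by apply: leq_sum => e _; case: ifP => //; rewrite ltnS.
rewrite (bigID (fun e => len e < 2 ^ k.+2)) /=.
have lt2 : 2 ^ k.+2 < 2 ^ k.+3 by rewrite ltn_exp2l.
rewrite (eq_bigl (fun e => len e < 2 ^ k.+2)) => [|e]; last by lia.
rewrite [X in _ + X](eq_bigl (fun e => 2 ^ k.+2 <= len e < 2 ^ k.+3)) => [|e]; last by lia.
apply: leq_trans (leq_add IH (sum_len_level (isT : 1 < k.+2))) _.
have : 4 <= 2 ^ k.+2 by rewrite -[4]/(2 ^ 2) leq_exp2l.
rewrite -addnA leq_add2l -mulnDl leq_mul2r -mulnDr leq_mul2l (expnS 2 k.+2); lia.
Qed.

Lemma sum_len_bound : 0 < n ->
  \sum_(0 <= e < n.+1) len e <= 72 * n * (7 + trunc_log 2 D).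
Proof.
move=> n0; set L := 7 + _.
(* The cutoff [2 ^ k.+2] is about [n / D], which balances both parts. For [I <= 2] truncation gives
   [k = 0], and no dyadic level remains in the short part. *)
pose I := trunc_log 2 (n %/ D); pose k := I - 2.
have ltn2 : n < 2 ^ I.+1 * D by rewrite -ltn_divLR ?trunc_log_ltn //; lia.
have short : 60 * D * (2 ^ k.+2 - 4) <= 60 * n.
  case: (leqP I 2) => [I2|I2].
    have -> : k = 0 by rewrite /k; lia.
    by rewrite muln0.
  have eI : k.+2 = I by rewrite /k; lia.
  have nD : 0 < n %/ D by move: I2; rewrite /I; case: (n %/ D).
  have := trunc_logP (isT : 1 < 2) nD; rewrite -/I leq_divRL; last by lia.
  by rewrite eI; nia.
have long : n < 8 * D * 2 ^ k.
  apply: leq_trans ltn2 _; rewrite (_ : 8 * D * 2 ^ k = 2 ^ (3 + k) * D).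
    by rewrite leq_mul2r leq_exp2l //; apply/orP; right; rewrite /k; lia.
  by rewrite expnD; nia.
rewrite (bigID (fun e => len e < 2 ^ k.+2)) /=.
have e4 : 2 ^ k.+2 = 4 * 2 ^ k by rewrite !expnS; lia.
rewrite [X in _ + X](eq_bigl (fun e => 4 * 2 ^ k <= len e)) => [|e]; last first.
  by rewrite -leqNgt e4.
have k0 : 0 < 2 ^ k by rewrite expn_gt0.
apply: leq_trans (leq_add (sum_len_short k) (sum_len_long k0 long)) _.
rewrite -/L; have : 7 <= L by rewrite leq_addr.
by move: short; set X := 60 * D * _; move: X; nia.
Qed.

End Levels.

(** * From texts and net occurrences to windows *)

Lemma count_gt1_other (B : eqType) (p : pred B) (L : seq B) x :
  uniq L -> 1 < count p L -> exists y, [/\ y \in L, p y & y != x].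
Proof.
move=> uL c2; have : ~~ all (pred1 x) (seq.filter p L).
  apply: contraL c2 => /allP sub; rewrite -leqNgt -size_filter.
  apply: (@uniq_leq_size _ _ [:: x]); first exact: filter_uniq.
  by move=> y /sub /=; rewrite inE.
move=> /allPn[y]; rewrite mem_filter => /andP[py yL] /= yx; exists y; split=> //.
Qed.

Lemma count_eq1_inj (B : eqType) (p : pred B) (L : seq B) x y :
  count p L = 1 -> x \in L -> y \in L -> p x -> p y -> x = y.
Proof.
rewrite -size_filter => c1 xL yL px py.
have : x \in seq.filter p L by rewrite mem_filter px.
have : y \in seq.filter p L by rewrite mem_filter py.
by case: (seq.filter p L) c1 => [|z []] //= _; rewrite !inE => /eqP-> /eqP->.
Qed.

Section TextWindows.
Variables (A : eqType) (T : seq A).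
Local Notation n := (size T).

(* Beyond the end the text is padded with pairwise distinct fresh letters,
   so that windows are never truncated. *)
Definition letter i := if drop i T is x :: _ then index x T else n + i.

Lemma letter_ge i : n <= i -> letter i = n + i.
Proof. by move=> le; rewrite /letter drop_oversize. Qed.

Lemma letterE x0 i : i < n -> letter i = index (nth x0 T i) T.
Proof. by move=> lt; rewrite /letter (drop_nth x0). Qed.

Lemma letter_lt i : i < n -> letter i < n.
Proof.
move=> lt; rewrite /letter; case E : (drop i T) => [|x s].
  by move/(congr1 size): E; rewrite size_drop /=; lia.
by rewrite index_mem; apply: (mem_drop (n0 := i)); rewrite E mem_head.
Qed.

Lemma weq_inside l p q : 0 < l -> p + l <= n -> weq letter l p q -> q + l <= n.
Proof.
move=> l0 pn /weqP/(_ l.-1); rewrite prednK // => /(_ (leqnn l)) e.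
rewrite leqNgt; apply/negP => lt.
have lt1 : p + l.-1 < n by lia.
have le2 : n <= q + l.-1 by lia.
by have := letter_lt lt1; rewrite e letter_ge //; lia.
Qed.

(** The last letter of the window is padding, which identifies its position. *)
Lemma weq_past_end l p q : 0 < l -> n < p + l -> weq letter l p q -> q = p.
Proof.
move=> l0 pn w; have nq : n < q + l.
  by rewrite ltnNge; apply/negP => qn; move: w; rewrite weq_sym => /(weq_inside l0 qn); lia.
move/weqP/(_ l.-1): w; rewrite prednK // => /(_ (leqnn l)).
by rewrite !letter_ge; lia.
Qed.

Lemma weq_substr l p q : p + l <= n -> q + l <= n ->
  weq letter l p q = (take l (drop p T) == take l (drop q T)).
Proof.
move=> pn qn; case: l pn qn => [|l] pn qn; first by rewrite !take0 eqxx.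
have x0 : A by case: (T) pn => [|x ?] //; rewrite addnS.
have sz r : r + l.+1 <= n -> size (take l.+1 (drop r T)) = l.+1.
  by move=> le; rewrite size_take_min size_drop; lia.
apply/weqP/eqP => [w|w j lt].
  apply: (@eq_from_nth _ x0); rewrite !sz // => j lt.
  rewrite !nth_take // !nth_drop; have := w j lt.
  have lt1 : p + j < n by lia.
  have lt2 : q + j < n by lia.
  rewrite !(letterE x0) // => e.
  by rewrite -(nth_index x0 (mem_nth x0 lt1)) e nth_index ?mem_nth.
have lt1 : p + j < n by lia.
have lt2 : q + j < n by lia.
rewrite !(letterE x0) //; move: (congr1 (fun s => nth x0 s j) w).
by rewrite !nth_take // !nth_drop => ->.
Qed.

Lemma mem_intervals s e : ((s, e) \in intervals T) = (1 <= s <= e) && (e <= n).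
Proof.
apply/allpairsPdep/idP => [[s' [e' [+ + [-> ->]]]]|h].
  by rewrite !mem_iota; lia.
by exists s, e; rewrite !mem_iota; split => //; lia.
Qed.

Lemma intervals_uniq : uniq (intervals T).
Proof.
apply: allpairs_uniq_dep => [|s _|]; rewrite ?iota_uniq //.
by move=> [s e] [s' e'] _ _ /= [-> ->].
Qed.

Lemma substringE x l : substring T x.+1 (x + l) = take l (drop x T).
Proof. by rewrite /substring take_drop addnC. Qed.

Lemma size_substring s e : 0 < s -> e <= n -> size (substring T s e) = e.+1 - s.
Proof. by move=> s0 en; rewrite /substring size_drop size_take_min; lia. Qed.

Lemma freq_gt1P x l : 0 < l -> x + l <= n ->
  1 < freq T (substring T x.+1 (x + l)) ->
  exists y, [/\ y + l <= n, y != x & weq letter l x y].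
Proof.
move=> l0 xn /(count_gt1_other (x.+1, x + l) intervals_uniq).
move=> [[s e] [+ /= /eqP eqs ne]]; rewrite mem_intervals => se.
have := congr1 size eqs; rewrite !size_substring //; try lia.
move=> esz; have es : s = s.-1.+1 by lia.
have ee : e = s.-1 + l by lia.
exists s.-1; split; first by lia.
  by apply: contra ne => /eqP es1; rewrite ee es es1.
rewrite weq_substr //; last by lia.
by rewrite -!substringE -ee -es eqs.
Qed.

Lemma freq_eq1P x l q : 0 < l -> x + l <= n ->
  freq T (substring T x.+1 (x + l)) = 1 -> weq letter l x q -> q = x.
Proof.
move=> l0 xn c1 w; have qn := weq_inside l0 xn w.
suff [] : (q.+1, q + l) = (x.+1, x + l) by [].
apply: (count_eq1_inj c1); rewrite ?mem_intervals ?eqxx //; try lia.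
by rewrite /= !substringE -weq_substr // weq_sym.
Qed.

(** Half-open form [[x, x + l)] with [x = s - 1]. For [e = n] right uniqueness comes from the
    padding; left uniqueness needs a preceding letter, hence [0 < x]. *)
Lemma netP s e : net_occurrence T (s, e) ->
  let l := e.+1 - s in let x := e - l in
  [/\ 0 < l, l <= e <= n,
      exists y, [/\ y + l <= n, y != x & weq letter l x y],
      forall q, weq letter l.+1 x q -> q = x
    & forall q, 0 < x -> weq letter l.+1 x.-1 q -> q = x.-1].
Proof.
move=> /and4P[/andP[/andP[s1 se] en] f2 fl fr] l x.
have l0 : 0 < l by rewrite /l; lia.
have le : l <= e by rewrite /l; lia.
have ex : x + l = e by rewrite /x subnK.
have es : s = x.+1 by rewrite /x /l; lia.
split=> //; first by rewrite le.
- by apply: freq_gt1P; rewrite ?ex -?es.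
- move=> q; case/orP: fr => [/eqP een|/eqP f1].
    by apply: weq_past_end; lia.
  case: (ltnP n (x + l.+1)) => [lt|ge]; first exact: weq_past_end.
  by apply: freq_eq1P => //; rewrite addnS ex -es.
- move=> q x0; have nx : x.-1 + l.+1 = e by lia.
  apply: freq_eq1P => //; first by lia.
  rewrite nx; case/orP: fl => [/eqP ?|/eqP]; first by lia.
  by rewrite es prednK.
Qed.

(** If [s' < s], the repeat of the longer occurrence contains a repeat of the shorter one extended
    to the left, which is unique. By symmetry, an end carries at most one net occurrence. *)
Lemma net_start_unique s s' e :
  net_occurrence T (s, e) -> net_occurrence T (s', e) -> s <= s'.
Proof.
move=> N N'; have [l0 le _ _ lu] := netP N.
have [l0' le' [y [yn yx w]] _ _] := netP N'.
rewrite leqNgt; apply/negP => lt.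
move: lu yx w; set x := e - (e.+1 - s); set x' := e - (e.+1 - s') => lu /eqP yx w.
pose i := x.-1 - x'.
have ei : e.+1 - s' = i + (e.+1 - s).+1 by rewrite /i /x /x'; lia.
have ex : x.-1 = x' + i by rewrite /i /x /x'; lia.
have x0 : 0 < x by rewrite /x; lia.
have := lu (y + i) x0; rewrite ex ei in w *; move=> /(_ (weq_shift w)); lia.
Qed.

(** The sum has at most one term, by [net_start_unique]; the value 0 marks ends without a net
    occurrence. *)
Definition net_len e := \sum_(1 <= s < n.+1 | net_occurrence T (s, e)) (e.+1 - s).

Lemma net_lenP e : 0 < net_len e ->
  exists2 s, net_occurrence T (s, e) & net_len e = e.+1 - s.
Proof.
rewrite /net_len; case: (boolP (has (fun s => net_occurrence T (s, e)) (index_iota 1 n.+1))).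
  move=> /hasP[s sn N] _; exists s => //.
  rewrite big_mkcond (bigD1_seq s) ?iota_uniq // N big1 => [|s' /eqP ne]; first exact: addn0.
  case: ifP => // N'; have := net_start_unique N N'; have := net_start_unique N' N; lia.
by move=> /hasPn h; rewrite big_seq_cond big1 // => s /andP[/h /negbTE->].
Qed.

(** Exchange the sums over strings and occurrences: [net_strings] has no duplicates, so each
    occurrence counts at most once. *)
Lemma net_length_le : net_length T <= \sum_(0 <= e < n.+1) net_len e.
Proof.
apply: (@leq_trans (\sum_(p <- intervals T | net_occurrence T p) size (substring T p.1 p.2))).
  rewrite /net_length (eq_bigr (fun W => \sum_(p <- intervals T | net_occurrence T p)
    (substring T p.1 p.2 == W) * size (substring T p.1 p.2))) => [|W _]; last first.
    rewrite /net_freq -sum1_count big_distrl /= big_mkcondr; apply: eq_bigr => p _.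
    by case: eqP => [->|].
  rewrite exchange_big /=; apply: leq_sum => p _; rewrite -big_distrl /=.
  rewrite -[leqRHS]mul1n leq_mul2r; apply/orP; right.
  have <- : \sum_(W <- net_strings T | W == substring T p.1 p.2) 1 =
     \sum_(W <- net_strings T) (substring T p.1 p.2 == W).
    by rewrite big_mkcond; apply: eq_bigr => W _; rewrite eq_sym; case: eqP.
  by rewrite sum1_count count_uniq_mem ?filter_uniq ?undup_uniq // leq_b1.
have -> : \sum_(0 <= e < n.+1) net_len e = \sum_(1 <= s < n.+1)
    \sum_(0 <= e < n.+1) if net_occurrence T (s, e) then e.+1 - s else 0.
  by rewrite exchange_big; apply: eq_bigr => e _; rewrite /net_len big_mkcond.
rewrite big_mkcond big_allpairs_dep.
have -> : iota 1 n = index_iota 1 n.+1 by rewrite /index_iota subn1.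
apply: leq_sum_nat => s /andP[s0 sn].
rewrite (_ : iota s _ = index_iota s n.+1) //.
apply: leq_trans (leq_sum_nat_sub _ s (leqnn n.+1)).
apply: leq_sum_nat => e /andP[_ en]; case: ifP => // _.
by rewrite size_substring.
Qed.

Lemma size_le_substring_complexity m (xs : seq nat) :
  0 < m -> uniq xs -> {in xs, forall x, x + m <= n} ->
  {in xs &, forall x y, weq letter m x y -> x = y} ->
  size xs <= substring_complexity T m.
Proof.
move=> m0 uxs xn inj; pose w x := take m (drop x T).
rewrite /substring_complexity -size_filter -(size_map w); apply: uniq_leq_size.
  rewrite map_inj_in_uniq // => x y xx yx; rewrite /w => e.
  by apply: inj; rewrite // weq_substr ?xn // e.
move=> W /mapP[x xx ->]; have le := xn _ xx.
rewrite mem_filter /w size_take_min size_drop mem_undup.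
apply/andP; split; first by apply/eqP; lia.
apply/mapP; exists (x.+1, x + m); last by rewrite /= substringE.
by rewrite mem_intervals; lia.
Qed.

(** Leftmost windows inside the text are pairwise distinct substrings; at most [m] others overrun
    its end. *)
Lemma count_leftmost_le m : 0 < m ->
  count (leftmost letter m) (iota 0 n) <=
  (if m <= n then substring_complexity T m else 0) + m.
Proof.
move=> m0; pose p1 := predI (leftmost letter m) (fun x => x + m <= n).
pose p2 := predI (leftmost letter m) (fun x => n < x + m).
rewrite (@eq_count _ _ (predU p1 p2)) => [|x /=]; last first.
  by case: leqP; rewrite ?andbT ?andbF ?orbF.
apply: leq_trans (leq_addr (count (predI p1 p2) (iota 0 n)) _) _.
rewrite count_predUI; apply: leq_add; last first.
  rewrite -size_filter -[leqRHS](size_iota (n - m)); apply: uniq_leq_size.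
    by rewrite filter_uniq ?iota_uniq.
  by move=> x; rewrite mem_filter !mem_iota /= => /andP[/andP[_ ?] ?]; lia.
rewrite -size_filter; case: (leqP m n) => mn; last first.
  rewrite leqn0 size_eq0 -[_ == _]negbK -has_filter; apply/hasPn => x _ /=; lia.
apply: size_le_substring_complexity => //; first by rewrite filter_uniq ?iota_uniq.
  by move=> x; rewrite mem_filter => /andP[/andP[]].
have gap x y : leftmost letter m y -> weq letter m x y -> y <= x.
  move=> /leftmostP ly w; rewrite leqNgt; apply/negP => /ly.
  by rewrite weq_sym w.
move=> x y; rewrite !mem_filter => /andP[/andP[lx _] _] /andP[/andP[ly _] _] w.
have := gap _ _ ly w; rewrite weq_sym in w; have := gap _ _ lx w; lia.
Qed.

Lemma net_length_bound D : 0 < n -> 1 < D ->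
  (forall m, 0 < m <= n -> substring_complexity T m <= D * m) ->
  net_length T <= 72 * n * (7 + trunc_log 2 D).
Proof.
move=> n0 D1 SD; apply: leq_trans net_length_le _.
apply: (@sum_len_bound letter) => //.
- move=> m m0; apply: leq_trans (count_leftmost_le m0) _; rewrite leq_add2r.
  by case: (leqP m n) => // mn; apply: SD; rewrite m0.
- by move=> e /net_lenP[s /netP[]] ? ? _ _ _ ->.
- by move=> e q /net_lenP[s /netP[]] _ _ _ ru _ ->; apply: ru.
- move=> e /net_lenP[s /netP[]]; set l := e.+1 - s.
  move=> l0 le [y [yn yx w]] _ _ ->; exists (y + l).
  rewrite addnK leq_addl; split=> //.
  by apply: contra yx => /eqP <-; rewrite addnK.
Qed.

End TextWindows.

(** The sentinel differs from the first letter. Hence [delta] is at least 2, and additive constants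
    can be absorbed into its logarithm. *)
Lemma substring_complexity1_ge2 (A : eqType) (T : seq A) :
  1 < size T -> ends_with_sentinel T -> 2 <= substring_complexity T 1.
Proof.
move=> n2 [U [d [eT dU]]]; have sT : size T = (size U).+1 by rewrite eT size_rcons.
rewrite -[2]/(size [:: 0; size U]); apply: size_le_substring_complexity => //.
- by rewrite /= inE andbT; apply/eqP; lia.
- by move=> x; rewrite !inE => /orP[] /eqP->; lia.
suff ne : ~~ weq (letter T) 1 0 (size U).
  move=> x y; rewrite !inE => /orP[] /eqP-> /orP[] /eqP-> //; last first.
    by rewrite weq_sym (negbTE ne).
  by rewrite (negbTE ne).
rewrite /weq /= andbT !addn0 !(letterE d) ?sT ?ltnS //.
have U0 : 0 < size U by lia.
have -> : nth d T 0 = nth d U 0 by rewrite eT nth_rcons U0.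
have -> : nth d T (size U) = d by rewrite eT nth_rcons ltnn eqxx.
rewrite eT -!cats1 !index_cat mem_nth // (negbTE dU) /= eqxx addn0.
by rewrite neq_ltn index_mem mem_nth.
Qed.

(** * Passage to [delta] and real logarithms *)

Local Open Scope ring_scope.

Lemma substring_complexity_le_delta (R : realType) (A : eqType) (T : seq A) m :
  (0 < m <= size T)%N -> (substring_complexity T m)%:R <= delta R T * m%:R.
Proof.
move=> /andP[m0 mn]; rewrite -ler_pdivrMr ?ltr0n //.
by apply: (le_bigmax_seq _ m) => //; rewrite mem_index_iota m0.
Qed.

Theorem theorem24 (R : realType) :
  exists c : R, 0 < c /\
    forall (A : eqType) (T : seq A),
      (2 <= size T)%N -> ends_with_sentinel T ->
      (net_length T)%:R <= c * (size T)%:R * ln (delta R T).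
Proof.
have ln2_gt0 : 0 < ln 2 :> R by rewrite ln_gt0 // ltr1n.
(* [648 = 72 * 9], where [9 * ln (delta R T)] bounds [(7 + trunc_log 2 D) * ln 2]. *)
exists (648 / ln 2); split.
  by apply: divr_gt0; [rewrite ltr0n|].
move=> A T n2 sent.
have n0 : (0 < size T)%N by lia.
have d2 : 2 <= delta R T.
  have := @substring_complexity_le_delta R A T 1 n0; rewrite mulr1; apply: le_trans.
  by rewrite ler_nat substring_complexity1_ge2.
have d0 : 0 <= delta R T by lra.
pose D := (Num.truncn (delta R T)).+1.
have /andP[trunc_le lt_D] := truncn_itv d0.
have D1 : (1 < D)%N by rewrite ltnS -(ltr_nat R) ; lra.
have SD m : (0 < m <= size T)%N -> (substring_complexity T m <= D * m)%N.
  move=> mn; rewrite -(ler_nat R) natrM.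
  apply: le_trans (substring_complexity_le_delta R mn) _.
  by rewrite ler_wpM2r // ltW.
have := net_length_bound n0 D1 SD; rewrite -(ler_nat R) => /le_trans; apply.
set k := trunc_log 2 D; rewrite -/k.
(* This is [2 ^ k <= D <= delta + 1 <= 2 * delta] after taking logarithms. *)
have k_le : k%:R * ln 2 <= ln 2 + ln (delta R T).
  rewrite mulr_natl -lnXn // -lnM ?posrE //; last by lra.
  rewrite ler_ln ?posrE ?exprn_gt0 //; last by lra.
  have : (2 ^ k <= D)%N by apply: trunc_logP.
  rewrite -(ler_nat R) natrX => /le_trans; apply.
  by rewrite /D -natr1; lra.
have ln_le : ln 2 <= ln (delta R T) by rewrite ler_ln ?posrE //; lra.
have -> : 648 / ln 2 * (size T)%:R * ln (delta R T) =
    72 * (size T)%:R * (9 * ln (delta R T) / ln 2) by ring.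
rewrite !natrM natrD ler_wpM2l ?mulr_ge0 // ler_pdivlMr //; lra.
Qed.
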